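(* Let $N$ be a nowhere dense sublocale of a locale $L$. The following statements are equivalent. (1) $N$ is maximal nowhere dense. (2) There is no closed nowhere dense sublocale of $L$ having $N$ as its nowhere dense sublocale. (3) $\overline{N}$ is maximal nowhere dense. (4) $\overline{N}$ is not a nowhere dense sublocale of any closed nowhere dense sublocale of $L$. (5) There is no dense $y\in L$ such that $y\leq \bigwedge N$ and $\left(\bigwedge N\right)^{*\mathfrak{c}(y)}= y$.
   Context: $\mathsf{O}=\{1\}$ is the void sublocale, $\mathfrak{c}(y)=\{x\in L:y\le x\}$ is the closed sublocale induced by $y$, and $\overline{N}$ is the closure of $N$ in $L$ (smallest closed sublocale containing $N$). An element $y\in L$ is dense if $y\to 0=0$. For a sublocale $A$ of $L$ and $x\in A$, $x^{*A}$ denotes the pseudocomplement of $x$ computed in the locale $A$. A sublocale $N$ of $L$ is nowhere dense if $N\cap\mathfrak{B}L=\mathsf{O}$, where $\mathfrak{B}L=\{x\to 0:x\in L\}$ is the smallest dense sublocale of $L$. For a sublocale $S$ of $L$, ''$N$ is nowhere dense in $S$'' (or $N$ is a nowhere dense sublocale of $S$) means $N\subseteq S$ and $N$ is a nowhere dense sublocale of the locale $S$. A nowhere dense sublocale $N$ of $L$ is maximal nowhere dense if there is no nowhere dense sublocale $S$ of $L$ such that $N$ is nowhere dense in $S$. *)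

(* Defs.v *)
From HB Require Import structures.
From mathcomp Require Import all_boot all_order.
From mathcomp Require Import boolp classical_sets.

Set Implicit Arguments.
Unset Strict Implicit.
Unset Printing Implicit Defensive.

Import Order.TTheory.

(* `&` and `|` are the lattice operations; sets use them with %classic.       *)
Local Open Scope classical_set_scope.
Local Open Scope order_scope.

(* Pointfree topology: a locale is handled through its frame, i.e. a complete *)
(* lattice in which finite meets distribute over arbitrary joins.             *)
HB.mixin Record TBLattice_isLocale (d : Order.disp_t) L
    of Order.TBLattice d L := {
  bigjoin : set L -> L ;
  bigjoin_ub : forall (A : set L) x, A x -> x <= bigjoin A ;
  bigjoin_le : forall (A : set L) y,
    (forall x, A x -> x <= y) -> bigjoin A <= y ;
  meet_bigjoinr : forall x (A : set L),
    x `&` bigjoin A = bigjoin [set x `&` a | a in A]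
}.

#[short(type="localeType")]
HB.structure Definition Locale (d : Order.disp_t) :=
  {L of TBLattice_isLocale d L & Order.TBLattice d L}.

Section LocaleTheory.
Context {d : Order.disp_t} {L : localeType d}.
Implicit Types (x y z : L) (A : set L).

Definition bigmeet A : L := bigjoin [set y | forall x, A x -> y <= x].

Definition himp x y : L := bigjoin [set z | z `&` x <= y].

Definition pcompl x : L := himp x \bot.

Definition is_dense x : Prop := pcompl x = \bot.

Lemma bigmeet_lb A x : A x -> bigmeet A <= x.
Proof. by move=> Ax; apply: bigjoin_le => y; apply. Qed.

Lemma bigmeet_ge A y : (forall x, A x -> y <= x) -> y <= bigmeet A.
Proof. by move=> yA; apply: bigjoin_ub. Qed.

Lemma le_himp x y z : (z <= himp x y) = (z `&` x <= y).
Proof.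
apply/idP/idP => [zxy|]; last exact: bigjoin_ub.
apply: (le_trans (leI2 zxy (lexx x))); rewrite meetC meet_bigjoinr.
by apply: bigjoin_le => _ [t /= txy <-]; rewrite meetC.
Qed.

Lemma himp_mp x y : himp x y `&` x <= y.
Proof. by rewrite -le_himp. Qed.

Lemma le_himpr x y : y <= himp x y.
Proof. by rewrite le_himp leIl. Qed.

Lemma himp_bigmeet x A : himp x (bigmeet A) = bigmeet [set himp x a | a in A].
Proof.
apply/le_anti/andP; split.
  apply: bigmeet_ge => _ [a Aa <-]; rewrite le_himp.
  exact: le_trans (himp_mp _ _) (bigmeet_lb Aa).
rewrite le_himp; apply: bigmeet_ge => a Aa; rewrite -le_himp.
by apply: bigmeet_lb; exists a.
Qed.

Lemma himpA x y z : himp x (himp y z) = himp (x `&` y) z.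
Proof.
apply/le_anti/andP; split; rewrite !le_himp; last by rewrite -meetA himp_mp.
by rewrite meetA -le_himp himp_mp.
Qed.

End LocaleTheory.

Record sublocale (d : Order.disp_t) (L : localeType d) := Sublocale {
  sl_set :> set L ;
  sl_bigmeet : forall A : set L, A `<=` sl_set -> sl_set (bigmeet A) ;
  sl_himp : forall x s : L, sl_set s -> sl_set (himp x s)
}.

(* The type underlying a sublocale S, itself a locale for the induced order.  *)
Definition locale_of (d : Order.disp_t) (L : localeType d) (S : sublocale L) :
  Type := {x : L | x \in (S : set L)}.

Section SublocaleLocale.
Context {d : Order.disp_t} {L : localeType d} (S : sublocale L).

HB.instance Definition _ := SubChoice.on (locale_of S).
HB.instance Definition _ := [SubChoice_isSubPOrder of locale_of S by <: with d].

Definition to_locale (x : L) (Sx : sl_set S x) : locale_of S := exist _ x (mem_set Sx).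

Lemma valS (x : locale_of S) : sl_set S (\val x).
Proof. exact: set_mem (valP x). Qed.

Lemma le_valS (x y : locale_of S) : (x <= y) = (\val x <= \val y).
Proof. by []. Qed.

Lemma le_to_locale (x : locale_of S) (y : L) (Sy : sl_set S y) :
  (\val x <= y) = (x <= to_locale Sy).
Proof. by []. Qed.

(* The smallest element of S above x.                                         *)
Definition nucleus (x : L) : locale_of S :=
  to_locale (sl_bigmeet (fun s (h : (S `&` [set s | x <= s])%classic s) => h.1)).

Lemma nucleus_le (x : L) (s : locale_of S) : (nucleus x <= s) = (x <= \val s).
Proof.
rewrite le_valS; apply/idP/idP => [|xs].
  by apply: le_trans; apply: bigmeet_ge => t [].
by apply: bigmeet_lb; split => //; exact: valS.
Qed.

Lemma sl_meet (x y : L) : sl_set S x -> sl_set S y -> sl_set S (x `&` y).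
Proof.
move=> Sx Sy; suff -> : x `&` y = bigmeet [set z | z = x \/ z = y].
  by apply: sl_bigmeet => z [] ->.
apply/le_anti/andP; split.
  by apply: bigmeet_ge => z [] ->; rewrite ?leIl ?leIr.
by rewrite lexI !bigmeet_lb //; [right | left].
Qed.

Lemma sl_top : sl_set S \top.
Proof.
suff -> : \top = bigmeet set0 :> L by apply: sl_bigmeet.
by apply/le_anti; rewrite lex1 andbT; apply: bigmeet_ge.
Qed.

Definition S_meet (x y : locale_of S) : locale_of S :=
  to_locale (sl_meet (valS x) (valS y)).

Definition S_join (x y : locale_of S) : locale_of S :=
  nucleus (\val x `|` \val y).

Fact S_lexI (z x y : locale_of S) :
  (z <= S_meet x y) = (z <= x) && (z <= y).
Proof. by rewrite !le_valS lexI. Qed.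

Fact S_leUx (x y z : locale_of S) :
  (S_join x y <= z) = (x <= z) && (y <= z).
Proof. by rewrite nucleus_le leUx !le_valS. Qed.

HB.instance Definition _ :=
  Order.POrder_isMeetSemilattice.Build d (locale_of S) S_lexI.
HB.instance Definition _ :=
  Order.POrder_isJoinSemilattice.Build d (locale_of S) S_leUx.

Lemma val_meet (x y : locale_of S) : \val (x `&` y) = \val x `&` \val y.
Proof. by []. Qed.

Fact S_le0x (x : locale_of S) : nucleus \bot <= x.
Proof. by rewrite nucleus_le le0x. Qed.

Fact S_lex1 (x : locale_of S) : x <= to_locale sl_top.
Proof. by rewrite le_valS lex1. Qed.

HB.instance Definition _ := Order.hasBottom.Build d (locale_of S) S_le0x.
HB.instance Definition _ := Order.hasTop.Build d (locale_of S) S_lex1.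

Definition S_bigjoin (A : set (locale_of S)) : locale_of S :=
  nucleus (bigjoin [set \val a | a in A]).

Fact S_bigjoin_ub (A : set (locale_of S)) x : A x -> x <= S_bigjoin A.
Proof.
move=> Ax; rewrite le_valS.
apply: (@le_trans _ _ (bigjoin [set \val a | a in A])).
  by apply: bigjoin_ub; exists x.
by rewrite -nucleus_le.
Qed.

Fact S_bigjoin_le (A : set (locale_of S)) y :
  (forall x, A x -> x <= y) -> S_bigjoin A <= y.
Proof.
move=> Ay; rewrite nucleus_le; apply: bigjoin_le => _ [x Ax <-].
by rewrite -le_valS Ay.
Qed.

Fact S_meet_bigjoinr (x : locale_of S) (A : set (locale_of S)) :
  x `&` S_bigjoin A = S_bigjoin [set x `&` a | a in A].
Proof.
apply/le_anti/andP; split; last first.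
  apply: S_bigjoin_le => _ [a Aa <-].
  by rewrite leI2 // S_bigjoin_ub.
set y := S_bigjoin [set _ | _ in _].
have Sxy : sl_set S (himp (\val x) (\val y)) by apply: sl_himp; exact: valS.
rewrite meetC le_valS val_meet -le_himp (le_to_locale _ Sxy).
apply: S_bigjoin_le => a Aa; rewrite -le_to_locale le_himp -val_meet -le_valS.
by apply: S_bigjoin_ub; exists a => //; rewrite meetC.
Qed.

HB.instance Definition _ := TBLattice_isLocale.Build d (locale_of S)
  S_bigjoin_ub S_bigjoin_le S_meet_bigjoinr.

Lemma val_bigmeet (A : set (locale_of S)) :
  \val (bigmeet A) = bigmeet [set \val a | a in A].
Proof.
have SA : sl_set S (bigmeet [set \val a | a in A]).
  by apply: sl_bigmeet => _ [a _ <-]; exact: valS.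
apply/le_anti/andP; split.
  by apply: bigmeet_ge => _ [a Aa <-]; rewrite -le_valS; exact: bigmeet_lb.
rewrite -[X in X <= _]/(\val (to_locale SA)) -le_valS.
by apply: bigmeet_ge => a Aa; rewrite le_valS; apply: bigmeet_lb; exists a.
Qed.

Lemma val_himp (x y : locale_of S) :
  \val (himp x y) = himp (\val x) (\val y).
Proof.
have Sxy : sl_set S (himp (\val x) (\val y)) by apply: sl_himp; exact: valS.
apply/le_anti/andP; split.
  by rewrite le_himp -val_meet -le_valS himp_mp.
rewrite -[X in X <= _]/(\val (to_locale Sxy)) -le_valS le_himp.
by rewrite le_valS val_meet; exact: himp_mp.
Qed.

Lemma himp_nucleus (x : L) (s : locale_of S) :
  himp (\val (nucleus x)) (\val s) = himp x (\val s).
Proof.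
have Sxs : sl_set S (himp x (\val s)) by apply: sl_himp; exact: valS.
apply/le_anti/andP; split; rewrite le_himp.
  apply: le_trans (himp_mp (\val (nucleus x)) _); rewrite leI2 //.
  by rewrite -nucleus_le.
rewrite meetC -le_himp.
have Sh : sl_set S (himp (himp x (\val s)) (\val s)) by apply: sl_himp; exact: valS.
by rewrite (le_to_locale _ Sh) nucleus_le le_himp meetC himp_mp.
Qed.

End SublocaleLocale.

Section Sublocales.
Context {d : Order.disp_t} {L : localeType d}.
Implicit Types (x y : L) (N S : sublocale L).

Fact trace_bigmeet S N (A : set (locale_of S)) :
  A `<=` [set x | sl_set N (\val x)] -> sl_set N (\val (bigmeet A)).
Proof.
by move=> NA; rewrite val_bigmeet; apply: sl_bigmeet => _ [a Aa <-]; exact: NA.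
Qed.

Fact trace_himp S N (x s : locale_of S) :
  sl_set N (\val s) -> sl_set N (\val (himp x s)).
Proof. by move=> Ns; rewrite val_himp; exact: sl_himp. Qed.

(* The trace of N on S, as a sublocale of the locale S. When N is contained   *)
(* in S it is N itself, seen inside S.                                        *)
Definition trace S N : sublocale (locale_of S) :=
  Sublocale (@trace_bigmeet S N) (@trace_himp S N).

Fact void_bigmeet (A : set L) : A `<=` [set \top] -> [set \top] (bigmeet A).
Proof.
move=> AO /=; apply/le_anti; rewrite lex1 andTb.
by apply: bigmeet_ge => x /AO ->.
Qed.

Fact void_himp x s : [set \top] s -> [set \top] (himp x s).
Proof. by move=> ->; apply/le_anti; rewrite lex1 andTb le_himpr. Qed.

Definition void_sl : sublocale L := Sublocale void_bigmeet void_himp.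

Fact closed_bigmeet y (A : set L) :
  A `<=` [set x | y <= x] -> [set x | y <= x] (bigmeet A).
Proof. by move=> yA; apply: bigmeet_ge => x /yA. Qed.

Fact closed_himp y x s : [set x | y <= x] s -> [set x | y <= x] (himp x s).
Proof. by move=> /= ys; exact: le_trans ys (le_himpr x s). Qed.

Definition closed_sl y : sublocale L :=
  Sublocale (@closed_bigmeet y) (@closed_himp y).

Fact booleanization_bigmeet (A : set L) :
  A `<=` range pcompl -> range pcompl (bigmeet A).
Proof.
move=> Apc; exists (bigjoin [set pcompl a | a in A]) => //.
apply/le_anti/andP; split; last first.
  rewrite le_himp meet_bigjoinr; apply: bigjoin_le => _ [_ [a Aa <-] <-].
  rewrite -le_himp; apply: le_trans (bigmeet_lb Aa) _.
  by rewrite le_himp meetC himp_mp.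
apply: bigmeet_ge => a Aa; have [b _ ab] := Apc _ Aa.
apply: (@le_trans _ _ (pcompl (pcompl a))).
  rewrite le_himp; apply: le_trans (himp_mp (bigjoin [set pcompl c | c in A]) _).
  by apply: leI2 => //; apply: bigjoin_ub; exists a.
rewrite -ab le_himp; apply: le_trans (himp_mp (pcompl (pcompl b)) _).
by apply: leI2 => //; rewrite le_himp meetC himp_mp.
Qed.

Fact booleanization_himp x s :
  range pcompl s -> range pcompl (himp x s).
Proof. by move=> [y _ <-]; exists (x `&` y) => //; rewrite /pcompl himpA. Qed.

Definition booleanization : sublocale L :=
  Sublocale booleanization_bigmeet booleanization_himp.

Definition is_closed S : Prop := exists y, S = closed_sl y.

Definition closure_set N : set L :=
  [set x | forall C : sublocale L, is_closed C -> N `<=` C -> sl_set C x].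

Fact closure_bigmeet N (A : set L) :
  A `<=` closure_set N -> closure_set N (bigmeet A).
Proof. by move=> NA C clC NC; apply: sl_bigmeet => x /NA Nx; exact: Nx. Qed.

Fact closure_himp N x s : closure_set N s -> closure_set N (himp x s).
Proof. by move=> Ns C clC NC; apply: sl_himp; exact: Ns. Qed.

(* That this is the smallest closed sublocale containing N is closure_closed, *)
(* sub_closure and closure_min.                                               *)
Definition sl_closure N : sublocale L :=
  Sublocale (@closure_bigmeet N) (@closure_himp N).

Lemma sublocale_eq N S : N = S :> set L -> N = S.
Proof.
case: N S => [A Am Ah] [B Bm Bh] /= AB; case: _ / AB in Bm Bh *.
by congr Sublocale; exact: Prop_irrelevance.
Qed.

Lemma sub_closure N : N `<=` sl_closure N.
Proof. by move=> x Nx C _ NC; exact: NC. Qed.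

Lemma closure_min N S : is_closed S -> N `<=` S -> sl_closure N `<=` S.
Proof. by move=> clS NS x Nx; exact: Nx. Qed.

Lemma closure_closed N : is_closed (sl_closure N).
Proof.
exists (bigmeet N); apply/sublocale_eq/seteqP; split=> [x|x Nx _ [y ->] Ny].
  by apply => [|z]; [exists (bigmeet N) | exact: bigmeet_lb].
by apply: le_trans Nx; exact: bigmeet_ge.
Qed.

End Sublocales.

Arguments void_sl {d} L.
Arguments booleanization {d} L.

Section NowhereDense.

Definition nowhere_dense (d : Order.disp_t) (L : localeType d)
  (N : sublocale L) : Prop := (N `&` booleanization L)%classic = void_sl L.

Context {d : Order.disp_t} {L : localeType d}.
Implicit Types N S : sublocale L.

Definition nowhere_dense_in S N : Prop :=
  N `<=` S /\ nowhere_dense (trace S N).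

Definition maximal_nowhere_dense N : Prop :=
  nowhere_dense N /\
  ~ exists S : sublocale L, nowhere_dense S /\ nowhere_dense_in S N.

(* x^{*A}, for x in the sublocale A; the result is read back in L.            *)
Definition pcompl_in (A : sublocale L) (x : L) (Ax : sl_set A x) : L :=
  \val (pcompl (to_locale Ax)).

End NowhereDense.

(* Main.v *)
Require Import Defs.
From mathcomp Require Import all_boot all_order.
From mathcomp Require Import boolp classical_sets.

(** A sublocale is nowhere dense iff its meet is a dense element. Applied inside
    a locale S, whose bottom is the meet of S, this says that N is nowhere dense
    in S iff N is contained in S and (/\N) -> (/\S) = /\S. Both conditions on S
    see only /\S, up to containment, so S may be replaced by its closure, and
    likewise N, and the existence of S becomes that of the dense element
    y = /\S. *)

Import Order.TTheory.

Local Open Scope order_scope.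
Local Open Scope classical_set_scope.

Section NowhereDenseMeet.
Context {d : Order.disp_t}.

Lemma sl_set_bigmeet (L : localeType d) (N : sublocale L) :
  sl_set N (bigmeet N).
Proof. exact: sl_bigmeet. Qed.

(** Write a for the meet of [N] and x* for [pcompl x]. The element a** is regular and lies in [N],
    so it is top if [N] is nowhere dense; then a* <= a and a* = 0. Conversely, a regular c* in [N]
    lies above a, so c <= a* = 0 and c* is top. *)
Lemma nowhere_denseP (L : localeType d) (N : sublocale L) :
  nowhere_dense N <-> is_dense (bigmeet N).
Proof.
set a := bigmeet N; split => [ndN|dense_a].
  apply/le_anti; rewrite le0x andbT.
  (* Since a and a* are disjoint, a* -> a equals a**, which is regular. *)
  have ha : himp (pcompl a) a = pcompl (pcompl a).
    apply/le_anti/andP; split; rewrite le_himp.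
      apply: le_trans (himp_mp a \bot).
      by rewrite lexI leIr himp_mp.
    exact: le_trans (himp_mp _ _) (le0x _).
  have : sl_set (void_sl L) (himp (pcompl a) a).
    rewrite -ndN; split; first by apply: sl_himp; exact: sl_set_bigmeet.
    by rewrite ha; exists (pcompl a).
  move=> /= h1; apply: le_trans (himp_mp a \bot).
  rewrite lexI lexx -[X in X <= a]meet1x -le_himp h1.
  exact: lexx.
apply/seteqP; split => [_ [/[swap] -[c _ <-] Nc]|_ ->].
  apply/le_anti; rewrite lex1 le_himp meet1x -dense_a le_himp.
  have := bigmeet_lb Nc; rewrite -/a le_himp meetC; exact.
by split; exact: sl_top.
Qed.

Context {L : localeType d}.
Implicit Types N S : sublocale L.

Lemma bigmeet_closed_sl (y : L) : bigmeet (closed_sl y) = y.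
Proof.
by apply/le_anti/andP; split; [apply: bigmeet_lb; exact: lexx|exact: bigmeet_ge].
Qed.

Lemma bigmeet_closure N : bigmeet (sl_closure N) = bigmeet N.
Proof.
apply/le_anti/andP; split.
  by apply: bigmeet_ge => x Nx; apply: bigmeet_lb; exact: sub_closure.
apply: bigmeet_ge => x /(_ (closed_sl (bigmeet N))); apply=> [|z].
  by exists (bigmeet N).
exact: bigmeet_lb.
Qed.

Lemma nowhere_dense_closure N : nowhere_dense N -> nowhere_dense (sl_closure N).
Proof. by rewrite !nowhere_denseP bigmeet_closure. Qed.

Lemma val_bot S : \val (\bot : locale_of S) = bigmeet S.
Proof.
apply/le_anti/andP; split; last by apply: bigmeet_lb; exact: valS.
exact: le0x (to_locale (sl_set_bigmeet L S)).
Qed.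

(** Meets and implications in the locale [S] are those of [L]; only the bottom changes, to the meet
    of [S]. *)
Lemma nowhere_dense_inP S N :
  nowhere_dense_in S N <->
  N `<=` S /\ himp (bigmeet N) (bigmeet S) = bigmeet S.
Proof.
suff E : N `<=` S -> nowhere_dense (trace S N) <->
    himp (bigmeet N) (bigmeet S) = bigmeet S.
  by split=> -[NS /(E NS)].
move=> NS; rewrite nowhere_denseP.
have trN : \val (bigmeet (trace S N)) = bigmeet N.
  rewrite val_bigmeet; congr bigmeet; apply/seteqP.
  split=> [_ [x Nx <-] //|x Nx].
  by exists (to_locale (NS _ Nx)).
have pc : \val (pcompl (bigmeet (trace S N))) = himp (bigmeet N) (bigmeet S).
  by rewrite val_himp trN val_bot.
split=> [dn|hS]; first by rewrite -pc dn val_bot.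
by apply: val_inj; rewrite pc hS val_bot.
Qed.

Lemma pcompl_in_closedE {x y : L} (yx : y <= x) :
  @pcompl_in d L (closed_sl y) x yx = himp x y.
Proof. by rewrite /pcompl_in val_himp val_bot bigmeet_closed_sl. Qed.

End NowhereDenseMeet.

Theorem proposition2p5 (d : Order.disp_t) (L : localeType d) (N : sublocale L)
    (hN : nowhere_dense N) :
  [<-> maximal_nowhere_dense N ;
       ~ (exists S : sublocale L,
            is_closed S /\ nowhere_dense S /\ nowhere_dense_in S N) ;
       maximal_nowhere_dense (sl_closure N) ;
       ~ (exists S : sublocale L,
            is_closed S /\ nowhere_dense S /\ nowhere_dense_in S (sl_closure N)) ;
       ~ (exists y : L,
            is_dense y /\
            exists yN : y <= bigmeet N,
              @pcompl_in d L (closed_sl y) (bigmeet N) yN = y)].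
Proof.
tfae.
- by move=> [_ maxN] [S [_ [ndS NS]]]; apply: maxN; exists S.
- move=> no_closed; split; first exact: nowhere_dense_closure.
  move=> [S [ndS /nowhere_dense_inP[NS hS]]]; apply: no_closed.
  (* [S] need not be closed, but its closure has the same meet, so density and [hS] carry over. *)
  exists (sl_closure S); split; first exact: Defs.closure_closed.
  split; first exact: nowhere_dense_closure.
  apply/nowhere_dense_inP; split.
    by move=> x /sub_closure /NS /sub_closure.
  by move: hS; rewrite !bigmeet_closure.
- by move=> [_ maxN] [S [_ [ndS NS]]]; apply: maxN; exists S.
- move=> no_closed [y [dense_y [yN]]]; rewrite pcompl_in_closedE => hy.
  (* [closed_sl y] has meet y, and being closed it contains the closure of [N] as soon as y <=
     /\N. *)
  apply: no_closed; exists (closed_sl y); split; first by exists y.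
  split; first by rewrite nowhere_denseP bigmeet_closed_sl.
  apply/nowhere_dense_inP; rewrite bigmeet_closure bigmeet_closed_sl.
  split=> //; apply: closure_min; first by exists y.
  by move=> x Nx; apply: le_trans yN _; exact: bigmeet_lb.
- move=> no_y; split=> // -[S [ndS /nowhere_dense_inP[NS hS]]]; apply: no_y.
  (* The meet of any such [S], closed or not, is a forbidden y. *)
  exists (bigmeet S); split; first exact/nowhere_denseP.
  have SN : bigmeet S <= bigmeet N.
    by apply: bigmeet_ge => x /NS; exact: bigmeet_lb.
  by exists SN; rewrite pcompl_in_closedE.
Qed.
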